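(* On completed ordered databases, NU default theories are at least as expressive as $datalog^+(1)$. That is: for a given finite domain of constants $\mathcal U$ and a fixed database schema, for every $datalog^+(1)$ program $P$ and every ground atom $g$ there exists an NU query form $qf$ such that, for every completed ordered relational database $db$ over $\mathcal U$ with that schema, $q_{qf}(db)=true$ if and only if $q_P(db)=true$.
   Context: **Default theories.** For a set of formulas $T$, $T^*$ is its logical closure; for a letter $a$, $\neg\neg a=a$. A normal mixed unary (NMU) default theory is a pair $(D,W)$ with $W$ a finite consistent set of propositional literals and $D$ a finite set of defaults $\frac{\alpha:\beta}{\beta}$, where $\beta$ is a single literal and the prerequisite $\alpha$ is empty or a single literal. It is normal unary (NU) if every prerequisite is empty or a positive literal. A set $\mathcal E$ is an extension of $(D,W)$ if $\mathcal E=\bigcup_{i\ge0}E_i$, where $E_0=W$ and $E_{i+1}=E_i^*\cup\{\beta \mid \frac{\alpha:\beta}{\beta}\in D,\ \alpha\in E_i \text{ (or } \alpha \text{ empty)},\ \neg\beta\notin\mathcal E\}$. $(D,W)\models\phi$ means that $\phi$ belongs to every extension of $(D,W)$. **Databases.** Databases are relational databases over a given (arbitrarily large) finite domain of constants $\mathcal U$, with a fixed schema. A database is completed if for each of its relations $R$ it also contains the complement relation $\overline R$ of the same schema, consisting of all tuples over $\mathcal U$ not in $R$. It is ordered if its schema contains relations $First$, $Succ$, $Last$ encoding a complete ordering of the elements of $\mathcal U$. $W_{db}=\{R(\mathbf a)\mid R \text{ is a relation in } db \text{ and } \mathbf a\in R\}$, whose ground atoms are regarded as propositional letters. **$datalog^+(1)$.**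 A $datalog^+(1)$ program is a finite set of rules $$p(\mathbf Y)\leftarrow q(\mathbf X_0),a_1(\mathbf X_1),\dots,a_m(\mathbf X_m),\mathit{not}\ a_{m+1}(\mathbf X_{m+1}),\dots,\mathit{not}\ a_n(\mathbf X_n)$$ with $0\le m\le n$, where $p$ and $q$ are intensional (non-database) predicates, the $a_i$ are extensional (database) predicates, and every body atom is optional; so each rule has at most one intensional atom in its body, which is positive, and negation is applied only to extensional atoms. Recursion is allowed, and variables range over $\mathcal U$. The query $q_P$ defined by $P$ and $g$ has $q_P(db)=true$ iff $P\cup W_{db}\models g$, i.e. $g$ belongs to the minimal model of $P\cup W_{db}$ (negated extensional atoms being evaluated on $db$). **NU query forms.** An NU query form is a pair $qf=\langle (D_{qf},\emptyset),a_{qf}\rangle$, where $a_{qf}$ is a positive literal and $D_{qf}$ is a set of NU defaults. Defaults containing variables are shorthand for the set of all propositional defaults obtained by consistently substituting elements of $\mathcal U$ for the variables. The form defines the query $q_{qf}$ with $q_{qf}(db)=true$ iff $(D_{qf},W_{db})\models a_{qf}$. *)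

(* Defs.v *)
From Stdlib Require List.
From mathcomp Require Import all_boot.

Set Implicit Arguments.
Unset Strict Implicit.
Unset Printing Implicit Defensive.

Inductive literal (L : Type) := Pos of L | Neg of L.

Definition neg_lit L (l : literal L) : literal L :=
  match l with Pos a => Neg a | Neg a => Pos a end.

Definition is_pos L (l : literal L) : bool := if l is Pos _ then true else false.

Definition lit_map L L' (f : L -> L') (l : literal L) : literal L' :=
  match l with Pos a => Pos (f a) | Neg a => Neg (f a) end.

Inductive form (L : Type) :=
  | FVar of L
  | FBot
  | FNot of form L
  | FAnd of form L & form L
  | FOr of form L & form L
  | FImp of form L & form L.
Arguments FBot {L}.

Fixpoint eval L (v : L -> bool) (phi : form L) : bool :=
  match phi with
  | FVar a => v a
  | FBot => false
  | FNot p => ~~ eval v p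
  | FAnd p q => eval v p && eval v q
  | FOr p q => eval v p || eval v q
  | FImp p q => eval v p ==> eval v q
  end.

Definition lit_form L (l : literal L) : form L :=
  match l with Pos a => FVar a | Neg a => FNot (FVar a) end.

Definition closure L (T : form L -> Prop) (phi : form L) : Prop :=
  forall v : L -> bool, (forall psi, T psi -> eval v psi) -> eval v phi.

(** [Default a b] is the normal default with prerequisite [a] (empty when
    [None]) whose justification and conclusion are both [b]. *)
Record default (L : Type) := Default {
  prereq : option (literal L);
  concl : literal L
}.

Definition default_map L L' (f : L -> L') (d : default L) : default L' :=
  Default (omap (lit_map f) (prereq d)) (lit_map f (concl d)).

Definition is_NU L (d : default L) : bool :=
  if prereq d is Some a then is_pos a else true.

Fixpoint stage L (D : default L -> Prop) (W : literal L -> Prop)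
    (E : form L -> Prop) (i : nat) (phi : form L) : Prop :=
  match i with
  | 0 => exists2 l, W l & phi = lit_form l
  | j.+1 =>
      closure (stage D W E j) phi \/
      exists d, [/\ D d,
        if prereq d is Some a then stage D W E j (lit_form a) else True,
        ~ E (lit_form (neg_lit (concl d))) &
        phi = lit_form (concl d)]
  end.

Definition extension L (D : default L -> Prop) (W : literal L -> Prop)
    (E : form L -> Prop) : Prop :=
  forall phi, E phi <-> exists i, stage D W E i phi.

Definition skeptically_entails L (D : default L -> Prop)
    (W : literal L -> Prop) (phi : form L) : Prop :=
  forall E, extension D W E -> E phi.

(** A schema of completed ordered databases: [compl R] names the complement
    relation of [R]. What the distinguished relations contain is required of
    databases, by [completed] and [ordered]. *)
Record schema := Schema {
  relname : finType;
  arity : relname -> nat;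
  compl : relname -> relname;
  First : relname;
  Succ : relname;
  Last : relname;
  arity_compl : forall R, arity (compl R) = arity R;
  arity_First : arity First = 1;
  arity_Succ : arity Succ = 2;
  arity_Last : arity Last = 1
}.

Definition database (S : schema) (U : finType) :=
  forall R : relname S, {set (arity R).-tuple U}.

(** The equality of underlying sequences identifies the two tuple types, whose
    lengths [arity R] and [arity (compl R)] are only provably equal. *)
Definition completed S U (db : database S U) : Prop :=
  forall (R : relname S) (t : (arity R).-tuple U)
         (t' : (arity (compl R)).-tuple U),
    t = t' :> seq U -> (t' \in db (compl R)) = (t \notin db R).

Definition ordered S U (db : database S U) : Prop :=
  exists le : rel U,
    [/\ reflexive le, antisymmetric le, transitive le & total le] /\
    [/\ forall t, t \in db (First S) <->
          exists2 x, t = [:: x] :> seq U & forall y, le x y,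
        forall t, t \in db (Succ S) <->
          exists x y, [/\ t = [:: x; y] :> seq U, x != y, le x y &
            forall z, le x z -> le z y -> z = x \/ z = y] &
        forall t, t \in db (Last S) <->
          exists2 x, t = [:: x] :> seq U & forall y, le y x].

Definition edb_atom (S : schema) (T : Type) :=
  {R : relname S & (arity R).-tuple T}.

(** A non-database predicate is identified by its name and its number of
    arguments; infinitely many names are available. *)
Definition idb_atom (T : Type) := (nat * seq T)%type.

Definition atom (S : schema) (T : Type) := (edb_atom S T + idb_atom T)%type.

Definition edb_map S T T' (f : T -> T') (A : edb_atom S T) : edb_atom S T' :=
  existT _ (projT1 A) (map_tuple f (projT2 A)).

Definition idb_map T T' (f : T -> T') (A : idb_atom T) : idb_atom T' :=
  (A.1, map f A.2).

Definition atom_map S T T' (f : T -> T') (A : atom S T) : atom S T' :=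
  match A with inl B => inl (edb_map f B) | inr B => inr (idb_map f B) end.

Definition holds S U (db : database S U) (A : edb_atom S U) : bool :=
  projT2 A \in db (projT1 A).

Inductive term (U : Type) (k : nat) := Var of 'I_k | Const of U.

Definition inst (U : Type) k (s : 'I_k -> U) (t : term U k) : U :=
  match t with Var i => s i | Const c => c end.

Record rule (S : schema) (U : Type) := Rule {
  rvars : nat;
  head : idb_atom (term U rvars);
  int_body : option (idb_atom (term U rvars));
  pos_body : seq (edb_atom S (term U rvars));
  neg_body : seq (edb_atom S (term U rvars))
}.

Definition program (S : schema) (U : Type) := seq (rule S U).

Definition is_model S (U : finType) (P : program S U) (db : database S U)
    (M : atom S U -> Prop) : Prop :=
  (forall A, holds db A -> M (inl A)) /\
  forall r, List.In r P -> forall s : 'I_(rvars r) -> U,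
    (if int_body r is Some q then M (inr (idb_map (inst s) q)) else True) ->
    (forall A, List.In A (pos_body r) -> M (inl (edb_map (inst s) A))) ->
    (forall A, List.In A (neg_body r) -> ~~ holds db (edb_map (inst s) A)) ->
    M (inr (idb_map (inst s) (head r))).

Definition minimal_model S (U : finType) (P : program S U)
    (db : database S U) (A : atom S U) : Prop :=
  forall M, is_model P db M -> M A.

Lemma minimal_model_is_model S (U : finType) (P : program S U)
    (db : database S U) : is_model P db (minimal_model P db).
Proof.
split=> [A hA M [hM _]|r hr s hq hpos hneg M hM]; first exact: hM.
apply: (hM.2 r hr s) => //.
- by case: (int_body r) hq => // q; apply.
- by move=> A hA; apply: hpos hA M hM.
Qed.

Definition program_query S (U : finType) (P : program S U) (g : atom S U)
    (db : database S U) : Prop :=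
  minimal_model P db g.

Record open_default (S : schema) (U : Type) := OpenDefault {
  dvars : nat;
  dbody : default (atom S (term U dvars))
}.

Record query_form (S : schema) (U : Type) := QueryForm {
  qf_defaults : seq (open_default S U);
  qf_goal : literal (atom S U);
  qf_NU : forall d, List.In d qf_defaults -> is_NU (dbody d);
  qf_goal_pos : is_pos qf_goal
}.

Definition ground_defaults S (U : Type) (D : seq (open_default S U))
    (e : default (atom S U)) : Prop :=
  exists2 d, List.In d D &
    exists s : 'I_(dvars d) -> U, e = default_map (atom_map (inst s)) (dbody d).

Definition W_db S (U : finType) (db : database S U)
    (l : literal (atom S U)) : Prop :=
  exists2 A, holds db A & l = Pos (inl A).

Definition form_query S (U : finType) (qf : query_form S U)
    (db : database S U) : Prop :=
  skeptically_entails (ground_defaults (qf_defaults qf)) (W_db db)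
    (lit_form (qf_goal qf)).

(* Main.v *)
(** A ground rule with intensional body [q], head [p] and extensional conditions
    is simulated through a fresh letter [r], its guard, by the defaults
    [q : r / r] and [r : p / p], together with [b : ~r / ~r] for each fact [b]
    that falsifies one of the conditions; on completed databases such a [b] is
    always an atom. If the conditions hold, [~r] is underivable, so every
    extension contains [p] as soon as it contains [q]; hence every extension
    contains the minimal model. Conversely, firing every applicable [~r] first
    yields an extension whose non-guard atoms are exactly the minimal model. *)
Require Import Defs.
From mathcomp Require Import all_boot boolp.
From Stdlib Require List.

Set Implicit Arguments.
Unset Strict Implicit.
Unset Printing Implicit Defensive.

(** * Propositional valuations and closures of sets of literals *)

Fixpoint letters L (phi : form L) : list L :=
  match phi with
  | FVar a => [:: a]
  | FBot => [::]
  | FNot p => letters p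
  | FAnd p q | FOr p q | FImp p q => letters p ++ letters q
  end.

Lemma eq_eval L (v w : L -> bool) (phi : form L) :
  (forall a, List.In a (letters phi) -> v a = w a) -> eval v phi = eval w phi.
Proof.
elim: phi => [a||p IHp|p IHp q IHq|p IHp q IHq|p IHp q IHq] //= H.
- by apply: H; left.
- by rewrite IHp.
all: by rewrite IHp ?IHq // => a Ha; apply: H; apply/List.in_or_app; auto.
Qed.

Lemma closure_incl L (T : form L -> Prop) phi : T phi -> Defs.closure T phi.
Proof. by move=> Tphi v; apply. Qed.

Definition lits L (G : literal L -> Prop) (phi : form L) : Prop :=
  exists2 l, G l & phi = lit_form l.

Definition consistent L (G : literal L -> Prop) : Prop :=
  forall a, G (Pos a) -> ~ G (Neg a).

(** Consistency yields two extreme models of [G]: one makes true only the letters that [G] asserts,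
    the other makes false only those that [G] denies. The first settles positive literals, the
    second negative ones. *)
Lemma closure_lits L (G : literal L -> Prop) l :
  consistent G -> Defs.closure (lits G) (lit_form l) -> G l.
Proof.
move=> Gcons; case: l => a /= H.
  apply/asboolP; apply: (H (fun b => `[< G (Pos b) >])).
  move=> _ [[b|b] Gb ->] /=; first exact/asboolP.
  by apply/asboolPn => /Gcons.
apply/asboolP/negPn; apply: (H (fun b => ~~ `[< G (Neg b) >])).
move=> _ [[b|b] Gb ->] /=; first by apply/asboolPn; apply: Gcons.
by rewrite negbK; apply/asboolP.
Qed.

(** * Monotonicity and compactness of the stages of an extension *)

Section Stages.
Variables (L : Type) (D : default L -> Prop) (W : literal L -> Prop).
Variable E : form L -> Prop.

Lemma stage_le i j phi : i <= j -> stage D W E i phi -> stage D W E j phi.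
Proof.
elim: j => [|j IH]; first by rewrite leqn0 => /eqP ->.
rewrite leq_eqVlt ltnS => /orP[/eqP -> //|/IH {}IH Hi].
by left; apply/closure_incl/IH.
Qed.

(** The literals of [G] may appear at unboundedly late stages, but finitely many letters involve
    finitely many of them, and stages increase, so a maximum works. *)
Lemma stage_uniform (G : literal L -> Prop) (s : list L) :
  (forall l, G l -> exists i, stage D W E i (lit_form l)) ->
  exists i, forall a, List.In a s ->
    (G (Pos a) -> stage D W E i (FVar a)) /\
    (G (Neg a) -> stage D W E i (FNot (FVar a))).
Proof.
move=> HG; elim: s => [|a s [i Hi]]; first by exists 0.
have HG' l : exists k, G l -> stage D W E k (lit_form l).
  by have [/HG [k Hk]|nG] := pselect (G l); [exists k|exists 0].
have [[j Hj] [k Hk]] := (HG' (Pos a), HG' (Neg a)).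
exists (maxn i (maxn j k)) => b [<-|/Hi [H1 H2]]; split.
- by move/Hj; apply: stage_le; rewrite !leq_max leqnn orbT.
- by move/Hk; apply: stage_le; rewrite !leq_max leqnn !orbT.
- by move/H1; apply: stage_le; rewrite leq_maxl.
- by move/H2; apply: stage_le; rewrite leq_maxl.
Qed.

(* Only the letters of [phi] matter, because a
   valuation can be corrected elsewhere to satisfy [G]. *)
Lemma stage_closure (G : literal L -> Prop) phi :
  consistent G -> (forall l, G l -> exists i, stage D W E i (lit_form l)) ->
  Defs.closure (lits G) phi -> exists i, stage D W E i phi.
Proof.
move=> Gcons HG Gphi; have [i Hi] := stage_uniform (letters phi) HG.
exists i.+1; left => v Hv.
pose w a := `[< G (Pos a) >] || v a && ~~ `[< G (Neg a) >].
rewrite (@eq_eval _ v w).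
  apply: Gphi => _ [[a|a] Ga ->] /=; first by rewrite /w asboolT.
  rewrite /w (asboolT Ga) andbF orbF; apply/asboolPn => Gp.
  exact: Gcons Gp Ga.
move=> a /Hi [H1 H2]; rewrite /w.
have [Gp|nGp] := asboolP (G (Pos a)); first exact: Hv _ (H1 Gp).
have [Gn|nGn] := asboolP (G (Neg a)); last by rewrite andbT.
by rewrite andbF; apply/negbTE/(Hv _ (H2 Gn)).
Qed.

End Stages.

(** * Guarded default theories over abstract letters and ground rules *)

Section Guarded.
Variables (L I : Type) (W : L -> Prop).
Variables (guard head : I -> L) (body : I -> option L) (block : I -> L -> Prop).
Variable D : default L -> Prop.

Definition blocked i := exists2 b, block i b & W b.

(** This stands for the minimal model of a ground program: extensional conditions are decided by [W]
    alone, so they enter as [~ blocked i] and the induction stays positive. *)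
Inductive least : L -> Prop :=
  | least_fact a : W a -> least a
  | least_rule i : ~ blocked i -> (forall b, body i = Some b -> least b) ->
      least (head i).

Lemma least_inv a : least a -> W a \/ exists i, a = head i.
Proof. by case=> {a} [a Wa|i _ _]; [left|right; exists i]. Qed.

Hypothesis guard_inj : injective guard.
Hypothesis guard_fact : forall i, ~ W (guard i).
Hypothesis head_guard : forall i j, head i <> guard j.
Hypothesis body_guard : forall i j, body i <> Some (guard j).
Hypothesis block_guard : forall i j, ~ block i (guard j).
Hypothesis block_head : forall i j, ~ block i (head j).
Hypothesis defaultsP : forall e, D e <-> exists i,
  [\/ e = Default (omap (@Pos L) (body i)) (Pos (guard i)),
      exists2 b, block i b & e = Default (Some (Pos b)) (Neg (guard i)) |
      e = Default (Some (Pos (guard i))) (Pos (head i))].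

Let facts (l : literal L) := exists2 a, W a & l = Pos a.

Lemma least_guard i : ~ least (guard i).
Proof. by move=> /least_inv [/guard_fact|[j /esym/head_guard]]. Qed.

Lemma least_block i b : block i b -> least b -> W b.
Proof.
move=> ib /least_inv [//|[j bE]].
by case: (@block_head i j); rewrite -bE.
Qed.

(** A single valuation that satisfies every stage and makes both letters true shows that neither
    negation is derivable. *)
Lemma extension_unblocked E i : extension D facts E -> ~ blocked i ->
  ~ E (FNot (FVar (guard i))) /\ ~ E (FNot (FVar (head i))).
Proof.
move=> extE nbi.
(* Blocking letters are true only as facts, guards of blocked rules only if [E] contains them; all
   other letters, in particular heads and unblocked guards, are true. *)
pose v a := `[< ((exists j, block j a) -> W a) /\
  (forall j, a = guard j -> blocked j -> E (FVar a)) >].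
have v_head j : v (head j).
  by apply/asboolP; split=> [[k /block_head]|k /head_guard].
have v_sound k phi : stage D facts E k phi -> eval v phi.
  elim: k phi => [|k IH] phi /=.
    move=> [_ [a Wa ->] ->] /=; apply/asboolP; split=> // j eq_a.
    by case: (@guard_fact j); rewrite -eq_a.
  move=> stphi; case: (stphi) => [clphi|[d [/defaultsP [j dj] dpre dE phiE]]].
    exact: clphi v IH.
  case: dj dpre dE phiE => [->|[b jb ->]|->] /= dpre dE phiE.
  - rewrite phiE; apply/asboolP; split=> [[m /block_guard]//|_ _ _].
    by rewrite -phiE; apply/extE; exists k.+1.
  (* The blocking letter [b] is true under [v], hence a fact, so [j] is blocked. Were its guard
     true, it would lie in [E], against the justification. *)
  - have /asboolP [Wb _] := IH _ dpre.
    rewrite phiE /=; apply/asboolPn => -[_ /(_ j erefl) Ej]; apply/dE/Ej.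
    by exists b => //; apply: Wb; exists j.
  - by rewrite phiE; apply: v_head.
split=> /extE [k /v_sound] /=; last by rewrite v_head.
move/asboolPn; apply; split=> [[j /block_guard]//|j /guard_inj <-].
by move/nbi.
Qed.

Lemma extension_least E a : extension D facts E -> least a -> E (FVar a).
Proof.
move=> extE; elim=> {a} [a Wa|i nbi _ IH].
  by apply/extE; exists 0, (Pos a) => //; exists a.
have [nEg nEh] := extension_unblocked extE nbi.
have [k Hk] : exists k, stage D facts E k.+1 (FVar (guard i)).
  have [k Hk] : exists k, if body i is Some b
      then stage D facts E k (FVar b) else True.
    case: (body i) IH => [b /(_ _ erefl)/extE //|_]; by exists 0.
  exists k; right; exists (Default (omap (@Pos L) (body i)) (Pos (guard i))).
  split=> //; first by apply/defaultsP; exists i; constructor 1.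
  by move: Hk => /=; case: (body i).
apply/extE; exists k.+2; right.
exists (Default (Some (Pos (guard i))) (Pos (head i))); split=> //.
by apply/defaultsP; exists i; constructor 3.
Qed.

Let fires i := ~ blocked i /\ forall b, body i = Some b -> least b.

(** A guard whose rule is neither blocked nor applicable is left undecided, since no default that
    fires concludes it or its negation. *)
Definition canonical_literal (l : literal L) : Prop :=
  match l with
  | Pos a => least a \/ exists2 i, fires i & a = guard i
  | Neg a => exists2 i, blocked i & a = guard i
  end.

Lemma canonical_literal_consistent : consistent canonical_literal.
Proof.
move=> a + [i bi eq_a]; rewrite {}eq_a.
by case=> [/least_guard //|[j [nbj _] /guard_inj eq_ij]]; rewrite eq_ij in bi.
Qed.

Definition canonical : form L -> Prop := Defs.closure (lits canonical_literal).

Lemma canonicalP l : canonical (lit_form l) <-> canonical_literal l.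
Proof.
split; first exact: (closure_lits canonical_literal_consistent).
by move=> Gl; apply: closure_incl; exists l.
Qed.

Lemma canonical_letter a : (forall i, a <> guard i) ->
  canonical (FVar a) -> least a.
Proof. by move=> ng /(canonicalP (Pos a)) [//|[i _ /ng]]. Qed.

Lemma stage_canonical k phi : stage D facts canonical k phi -> canonical phi.
Proof.
elim: k phi => [|k IH] phi /=.
  move=> [_ [a Wa ->] ->]; apply/canonicalP; left; exact: least_fact.
move=> [clphi v Hv|]; first by apply: clphi => psi /IH; apply.
move=> [d [/defaultsP [i di] dpre dE ->]]; apply/canonicalP.
case: di dpre dE => [->|[b ib ->]|->] /= dpre dE.
(* If [i] were blocked, [canonical] would deny its guard and defeat the justification. *)
- right; exists i => //; split=> [bi|b ibE].
    by apply/dE/(canonicalP (Neg _)); exists i.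
  rewrite ibE /= in dpre; apply: canonical_letter (IH _ dpre) => j bE.
  by apply: (@body_guard i j); rewrite ibE bE.
(* The blocking letter is not a guard, so it lies in [least]; being no head either, it is a fact. *)
- exists i => //; exists b => //; apply: least_block (ib) _.
  apply: canonical_letter (IH _ dpre) => j bE.
  by apply: (@block_guard i j); rewrite -bE.
- left; have /(canonicalP (Pos _)) [/least_guard //|] := IH _ dpre.
  by move=> [j [nbj jbody] /guard_inj ->]; apply: least_rule.
Qed.

(** The guard comes one stage after the body; its justification holds because [canonical] denies
    only blocked guards. *)
Lemma stage_fires i : ~ blocked i ->
  (forall b, body i = Some b -> exists k, stage D facts canonical k (FVar b)) ->
  exists k, stage D facts canonical k (FVar (guard i)).
Proof.
move=> nbi ibody.
have [k Hk] : exists k, if body i is Some b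
    then stage D facts canonical k (FVar b) else True.
  by case: (body i) ibody => [b /(_ _ erefl)//|_]; exists 0.
exists k.+1; right; exists (Default (omap (@Pos L) (body i)) (Pos (guard i))).
split=> //; first by apply/defaultsP; exists i; constructor 1.
  by move: Hk => /=; case: (body i).
by move=> /(canonicalP (Neg _)) [j bj /guard_inj eq_ij]; rewrite eq_ij in nbi.
Qed.

Lemma stage_least a : least a ->
  exists k, stage D facts canonical k (FVar a).
Proof.
elim=> {a} [a Wa|i nbi _ IH]; first by exists 0, (Pos a) => //; exists a.
have [k Hk] := stage_fires nbi IH.
exists k.+1; right; exists (Default (Some (Pos (guard i))) (Pos (head i))).
split=> //; first by apply/defaultsP; exists i; constructor 3.
by move=> /(canonicalP (Neg _)) [j _ /head_guard].
Qed.

Lemma canonical_extension : extension D facts canonical.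
Proof.
move=> phi; split=> [|[k]]; last exact: stage_canonical.
(* By compactness it suffices that each canonical literal is reached at some stage. *)
apply: stage_closure canonical_literal_consistent _.
move=> [a [/stage_least //|[i [nbi ibody] ->]]|a [i [b ib Wb] ->]].
  by apply: stage_fires => // b /ibody /stage_least.
(* The blocking fact is present at stage 0, so the negated guard appears at stage 1. *)
exists 1; right; exists (Default (Some (Pos b)) (Neg (guard i))); split=> //.
- by apply/defaultsP; exists i; constructor 2; exists b.
- by exists (Pos b) => //; exists b.
move=> /(canonicalP (Pos _)) [/least_guard //|[j [nbj _] /guard_inj eq_ij]].
by apply: nbj; rewrite -eq_ij; exists b.
Qed.

(** The canonical extension alone gives one direction; the other holds in every extension. Guards
    are excluded because those of firing rules belong to [canonical] but not to [least]. *)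
Lemma guarded_entails a : (forall i, a <> guard i) ->
  skeptically_entails D facts (FVar a) <-> least a.
Proof.
move=> ng; split=> [/(_ _ canonical_extension)|la E extE].
  exact: canonical_letter.
exact: extension_least.
Qed.

End Guarded.

(** * Membership in lists *)

Lemma List_In_enum (T : finType) (x : T) : List.In x (enum T).
Proof.
have : x \in enum T by rewrite mem_enum.
by elim: (enum T) => //= y s IH; rewrite inE => /orP[/eqP ->|/IH]; auto.
Qed.

Lemma List_In_nth T (x0 : T) (s : seq T) i :
  i < size s -> List.In (nth x0 s i) s.
Proof. by elim: s i => [|y s IH] [|i] //=; auto. Qed.

Lemma List_In_tnth T (s : seq T) x :
  List.In x s <-> exists i, x = tnth (in_tuple s) i.
Proof.
split=> [|[i ->]]; last by rewrite (tnth_nth x); apply: List_In_nth.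
elim: s => //= y s IH [->|/IH [i ->]]; first by exists ord0.
by exists (lift ord0 i); rewrite !(tnth_nth x).
Qed.

(** * Encoding a program by guarded defaults *)

Section Encoding.
Variables (S : schema) (U : finType).

Definition compl_atom T (A : edb_atom S T) : edb_atom S T :=
  existT (fun R => (arity R).-tuple T) (compl (projT1 A))
    (tcast (esym (arity_compl (projT1 A))) (projT2 A)).

Lemma holds_compl (db : database S U) T (f : T -> U) (A : edb_atom S T) :
  completed db -> holds db (edb_map f (compl_atom A)) = ~~ holds db (edb_map f A).
Proof.
by case: A => R t cdb; apply: cdb; rewrite /= val_tcast.
Qed.

(** The failure of a positive condition is itself a fact of the complement relation, so all blocking
    prerequisites are positive, as NU defaults demand. *)
Definition blockers (r : rule S U) : seq (edb_atom S (term U (rvars r))) :=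
  List.map (@compl_atom _) (pos_body r) ++ neg_body r.

Lemma blockersP (db : database S U) (r : rule S U) (s : 'I_(rvars r) -> U) :
  completed db ->
  (exists2 A, List.In A (blockers r) & holds db (edb_map (inst s) A)) <->
  ~ ((forall A, List.In A (pos_body r) -> holds db (edb_map (inst s) A)) /\
     (forall A, List.In A (neg_body r) -> ~~ holds db (edb_map (inst s) A))).
Proof.
move=> cdb; split=> [[A Ab hA]|H].
  case: (List.in_app_or _ _ _ Ab) hA => [/List.in_map_iff [B [<- BP]]|An] hA.
  - by case=> /(_ _ BP) hB _; rewrite holds_compl ?hB in hA.
  - by case=> _ /(_ _ An); rewrite hA.
apply: contrapT => nb; apply: H; split=> A AP.
  apply: contrapT => /negP hA; apply: nb.
  exists (compl_atom A); last by rewrite holds_compl.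
  by apply/List.in_or_app; left; apply: List.in_map.
apply/negP => hA; apply: nb; exists A => //.
by apply/List.in_or_app; right.
Qed.

(** Every variable of the rule is an argument, so a ground guard determines the substitution; the
    name [n] determines the rule. *)
Definition guard_atom n k : idb_atom (term U k) :=
  (n, [seq Var U i | i <- enum 'I_k]).

Definition rule_defaults n (r : rule S U) : seq (open_default S U) :=
  let guard : atom S _ := inr (guard_atom n (rvars r)) in
  [:: OpenDefault
        (Default (omap (fun q => Pos (inr q)) (int_body r)) (Pos guard)),
      OpenDefault (Default (Some (Pos guard)) (Pos (inr (Defs.head r)))) &
      List.map (fun A => OpenDefault (Default (Some (Pos (inl A))) (Neg guard)))
        (blockers r)].

Variables (P : program S U) (N : nat).

Let rule_ i := tnth (in_tuple P) i.

Definition encoding : seq (open_default S U) :=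
  List.flat_map (fun i : 'I_(size P) => rule_defaults (N + i) (rule_ i))
    (enum 'I_(size P)).

Lemma encoding_NU d : List.In d encoding -> is_NU (dbody d).
Proof.
move=> /List.in_flat_map [i [_ /= [<-|[<-|/List.in_map_iff [A [<- _]]]]]] //.
by rewrite /is_NU /=; case: (int_body _).
Qed.

(** This is the index type at which the abstract guarded theory is instantiated. *)
Definition ground_rule := {i : 'I_(size P) & 'I_(rvars (rule_ i)) -> U}.

Definition ground_guard (x : ground_rule) : atom S U :=
  inr (idb_map (inst (projT2 x)) (guard_atom (N + projT1 x) _)).

Definition ground_head (x : ground_rule) : atom S U :=
  inr (idb_map (inst (projT2 x)) (Defs.head (rule_ (projT1 x)))).

Definition ground_body (x : ground_rule) : option (atom S U) :=
  omap (fun q => inr (idb_map (inst (projT2 x)) q)) (int_body (rule_ (projT1 x))).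

Definition ground_block (x : ground_rule) (a : atom S U) : Prop :=
  exists2 A, List.In A (blockers (rule_ (projT1 x))) &
    a = inl (edb_map (inst (projT2 x)) A).

Lemma ground_guard_inj : injective ground_guard.
Proof.
move=> [i s] [j t] [/addnI/val_inj eq_ij].
(* Once the rules are identified, both substitutions have the same type, and they agree on the
   enumeration of all variables. *)
case: _ / eq_ij t => t; rewrite -!map_comp => /eq_in_map eq_st.
by congr existT; apply/funext => k; apply: eq_st; rewrite -enumT mem_enum.
Qed.

Lemma encodingP e : ground_defaults encoding e <-> exists x : ground_rule,
  [\/ e = Default (omap (@Pos _) (ground_body x)) (Pos (ground_guard x)),
      exists2 b, ground_block x b &
        e = Default (Some (Pos b)) (Neg (ground_guard x)) |
      e = Default (Some (Pos (ground_guard x))) (Pos (ground_head x))].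
Proof.
have bodyE i (s : 'I_(rvars (rule_ i)) -> U) :
    omap (lit_map (atom_map (inst s)))
      (omap (fun q => Pos (inr q)) (int_body (rule_ i))) =
    omap (@Pos (atom S U)) (ground_body (existT _ i s)).
  by rewrite /ground_body /=; case: (int_body _).
split.
  move=> [d /List.in_flat_map [i [_ /= di]] [s ->]].
  case: di s => [<-|[<-|/List.in_map_iff [A [<- Ab]]]] /= s;
    exists (existT _ i s).
  - by constructor 1; rewrite -bodyE.
  - by constructor 3.
  - by constructor 2; exists (inl (edb_map (inst s) A)) => //; exists A.
have enc (i : 'I_(size P)) d : List.In d (rule_defaults (N + i) (rule_ i)) -> List.In d encoding.
  by move=> di; apply/List.in_flat_map; exists i; split=> //; apply: List_In_enum.
move=> [[i s]] [->|[_ [A Ab ->] ->]|->].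
- eexists; first by apply: (enc i); left.
  by exists s; rewrite -bodyE.
- eexists.
    by apply: (enc i); right; right; apply/List.in_map_iff; exists A; split.
  by exists s.
- eexists; first by apply: (enc i); right; left.
  by exists s.
Qed.

Variable db : database S U.

Definition fact (a : atom S U) : Prop := exists2 A, holds db A & a = inl A.

Lemma W_dbE : W_db db = (fun l => exists2 a, fact a & l = Pos a).
Proof.
apply/funext => l; apply/propext; split=> [[A hA ->]|[_ [A hA ->] ->]].
  by exists (inl A) => //; exists A.
by exists A.
Qed.

Lemma ground_blockedP x : completed db ->
  let r := rule_ (projT1 x) in let s := projT2 x in
  ~ blocked fact ground_block x <->
  (forall A, List.In A (pos_body r) -> holds db (edb_map (inst s) A)) /\
  (forall A, List.In A (neg_body r) -> ~~ holds db (edb_map (inst s) A)).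
Proof.
move=> cdb r s.
have -> : blocked fact ground_block x <->
    exists2 A, List.In A (blockers r) & holds db (edb_map (inst s) A).
  split=> [[_ [A Ab ->] [B hB AB]]|[A Ab hA]].
    by exists A; rewrite // (inl_inj AB).
  by exists (inl (edb_map (inst s) A)); [exists A|exists (edb_map (inst s) A)].
by rewrite blockersP //; split=> [/contrapT|? ?].
Qed.

Lemma least_minimal_model a : completed db ->
  least fact ground_head ground_body ground_block a <-> minimal_model P db a.
Proof.
move=> cdb; have [facts rules] := minimal_model_is_model P db.
split=> [|mina].
  elim=> {a} [_ [A hA ->]|x /(ground_blockedP _ cdb) [hpos hneg] _ IH].
    exact: facts.
  apply: rules => //; first by apply/List_In_tnth; exists (projT1 x).
  - by move: IH; rewrite /ground_body; case: (int_body _) => // q; apply.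
  - by move=> A AP; apply: facts; apply: hpos.
(* Conversely, [least] is itself a model of the program. *)
apply: mina; split=> [A hA|r + s]; first by left; exists A.
move=> /List_In_tnth [i eq_r]; move: s; rewrite {}eq_r => s hq hpos hneg.
apply: (@least_rule _ _ _ _ _ _ (existT _ i s)).
  apply/ground_blockedP => //; split=> //= A /hpos lA.
  (* Heads are intensional, so an extensional atom of [least] can only be a fact. *)
  have [[B hB AB]|[]//] := least_inv lA.
  by rewrite (inl_inj AB).
by rewrite /ground_body /=; case: (int_body _) hq => //= q lq _ [<-].
Qed.

End Encoding.

(** With [N] above every intensional name, the guard names [N + i] clash neither with the program
    nor with the goal. *)
Lemma fresh_name S (U : finType) (P : program S U) (g : atom S U) :
  exists N,
    (forall r, List.In r P -> (Defs.head r).1 < N /\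
      forall q, int_body r = Some q -> q.1 < N) /\
    (forall q, g = inr q -> q.1 < N).
Proof.
elim: P => [|r P [N [HP Hg]]] /=.
  case: g => [A|q]; first by exists 0; split.
  by exists q.1.+1; split=> // _ [<-].
pose m := if int_body r is Some q then q.1.+1 else 0.
exists (maxn N (maxn (Defs.head r).1.+1 m)); split=> [r'|q /Hg]; last first.
  by move=> qN; rewrite leq_max qN.
case=> [<-|/HP [hN bN]]; last first.
  by split=> [|q /bN qN]; rewrite leq_max ?hN ?qN.
split=> [|q rq]; first by rewrite !leq_max leqnn orbT.
by rewrite !leq_max /m rq leqnn !orbT.
Qed.

Theorem theorem3p5 (S : schema) (U : finType) (P : program S U)
    (g : atom S U) :
  exists qf : query_form S U,
    forall db : database S U, completed db -> ordered db ->
      (form_query qf db <-> program_query P g db).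
Proof.
have [N [HP Hg]] := fresh_name P g.
have rule_in (x : ground_rule P) : List.In (tnth (in_tuple P) (projT1 x)) P.
  by apply/List_In_tnth; exists (projT1 x).
exists (@QueryForm S U (encoding P N) (Pos g) (@encoding_NU S U P N) isT).
move=> db cdb _; rewrite /form_query W_dbE /program_query -least_minimal_model //.
(* Facts and blockers are extensional, hence differ from guards and heads by constructor; heads,
   bodies and the goal differ from guards because their names lie below [N]. *)
apply: (guarded_entails (@ground_guard_inj S U P N)).
- by move=> x [].
- move=> x y [name_eq _]; have [+ _] := HP _ (rule_in x).
  by rewrite name_eq ltnNge leq_addr.
- move=> x y; rewrite /ground_body; have [_] := HP _ (rule_in x).
  case: (int_body _) => //= q /(_ _ erefl) + [name_eq _].
  by rewrite name_eq ltnNge leq_addr.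
- by move=> x y [].
- by move=> x y [].
- exact: encodingP.
- by move=> x /Hg /=; rewrite ltnNge leq_addr.
Qed.
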